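(* Let $a, b$ be positive integers with $4 \leq a \leq b$. Then $\mathcal{G}_{\mathcal{R}}(a,b) \geq b-2a+1$.
   Context: A position is an unordered pair $(a,b)$ of nonnegative integers (pile sizes). $\mathcal{R}$-Wythoff: a move either removes a positive number of tokens from the larger pile (or from either pile if both piles have equal size), or removes the same positive number of tokens from both piles. $\mathcal{G}_{\mathcal{R}}$ is the Sprague-Grundy function of $\mathcal{R}$-Wythoff: $\mathcal{G}_{\mathcal{R}}(p)=\mathrm{mex}\{\mathcal{G}_{\mathcal{R}}(q): q \text{ reachable from } p \text{ in one move}\}$, where $\mathrm{mex}(S)$ is the least nonnegative integer not in $S$ and $\mathrm{mex}\{\}=0$. *)

(* Defs.v *)
From mathcomp Require Import all_boot all_order all_algebra.

Set Implicit Arguments.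
Unset Strict Implicit.
Unset Printing Implicit Defensive.

(* A position is coded by an ordered pair of pile sizes.  The rules below are
   invariant under swapping the piles, so that everything descends to unordered
   pairs; see rwythoff_move_swap and grundyR_swap. *)
Definition position : Type := (nat * nat)%type.

Definition swap (p : position) : position := (p.2, p.1).

Inductive rwythoff_move : position -> position -> Prop :=
| MoveLeft a b k of 0 < k <= a & b <= a : rwythoff_move (a, b) (a - k, b)
| MoveRight a b k of 0 < k <= b & a <= b : rwythoff_move (a, b) (a, b - k)
| MoveBoth a b k of 0 < k <= minn a b :
    rwythoff_move (a, b) (a - k, b - k).

Definition options (p : position) : seq position :=
  let: (a, b) := p in
  (if b <= a then [seq (a - k, b) | k <- iota 1 a] else [::]) ++
  (if a <= b then [seq (a, b - k) | k <- iota 1 b] else [::]) ++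
  [seq (a - k, b - k) | k <- iota 1 (minn a b)].

Lemma optionsP (p q : position) : q \in options p <-> rwythoff_move p q.
Proof.
case: p => a b; rewrite /options !mem_cat; split.
  case/or3P.
  - case: ifP => // hab /mapP[k]; rewrite mem_iota add1n ltnS => hk ->.
    exact: MoveLeft.
  - case: ifP => // hab /mapP[k]; rewrite mem_iota add1n ltnS => hk ->.
    exact: MoveRight.
  - case/mapP=> k; rewrite mem_iota add1n ltnS => hk ->.
    exact: MoveBoth.
move=> m; inversion m as [a' b' k hk hab|a' b' k hk hab|a' b' k hk]; subst;
  apply/or3P.
- by apply: Or31; rewrite hab; apply/mapP; exists k; rewrite ?mem_iota ?add1n ?ltnS.
- by apply: Or32; rewrite hab; apply/mapP; exists k; rewrite ?mem_iota ?add1n ?ltnS.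
- by apply: Or33; apply/mapP; exists k; rewrite ?mem_iota ?add1n ?ltnS.
Qed.

Lemma rwythoff_move_swap (p q : position) :
  rwythoff_move p q -> rwythoff_move (swap p) (swap q).
Proof.
case=> a b k hk *; [exact: MoveRight | exact: MoveLeft |].
by apply: MoveBoth; rewrite minnC.
Qed.

Lemma rwythoff_move_lt (p q : position) :
  rwythoff_move p q -> q.1 + q.2 < p.1 + p.2.
Proof.
case=> a b k /andP[k0 hk] /=.
- by rewrite ltn_add2r ltn_subrL k0 (leq_trans k0 hk).
- by rewrite ltn_add2l ltn_subrL k0 (leq_trans k0 hk).
- move: hk; rewrite leq_min => /andP[ha hb].
  by rewrite -addSn leq_add ?leq_subr // ltn_subrL k0 (leq_trans k0 ha).
Qed.

Lemma mex_exists (s : seq nat) : exists n, n \notin s.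
Proof.
exists (sumn s).+1; apply/negP => h; move: (perm_sumn (perm_to_rem h)) => /= e.
by move: (leqnn (sumn s)); rewrite {1}e addSn ltnNge leq_addr.
Qed.

Definition mex (s : seq nat) : nat := ex_minn (mex_exists s).

Lemma eq_mex (s t : seq nat) : s =i t -> mex s = mex t.
Proof.
move=> st; rewrite /mex.
case: ex_minnP => m hm minm; case: ex_minnP => n hn minn.
by apply/eqP; rewrite eqn_leq minm ?st // minn // -st.
Qed.

(* The first argument is fuel: each move decreases the total number of tokens,
   so the total plus one suffices; grundyR_mex gives the mex recursion. *)
Fixpoint grundy_rec (n : nat) (p : position) : nat :=
  if n is m.+1 then mex [seq grundy_rec m q | q <- options p] else 0.

Definition grundyR (p : position) : nat := grundy_rec (p.1 + p.2).+1 p.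

Lemma grundy_rec_fuel (n : nat) (p : position) :
  p.1 + p.2 < n -> grundy_rec n p = grundyR p.
Proof.
rewrite /grundyR; move: {2 4}(_.+1) (ltnSn (p.1 + p.2)) => m.
elim: n m p => [|n IH] [|m] p //= hm hn.
congr mex; apply/eq_in_map => q /optionsP /rwythoff_move_lt hq.
by apply: IH; [exact: leq_trans hq hm | exact: leq_trans hq hn].
Qed.

Lemma grundyR_mex (p : position) :
  grundyR p = mex [seq grundyR q | q <- options p].
Proof.
rewrite {1}/grundyR /=; congr mex; apply/eq_in_map => q.
by move=> /optionsP /rwythoff_move_lt; exact: grundy_rec_fuel.
Qed.

Lemma grundyR_swap (p : position) : grundyR (swap p) = grundyR p.
Proof.
have swapK : involutive swap by case.
have [n] := ubnP (p.1 + p.2); elim: n p => // n IH p; rewrite ltnS => hp.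
rewrite (grundyR_mex (swap p)) (grundyR_mex p); apply: eq_mex => x.
apply/mapP/mapP => -[q /optionsP hq ->]; exists (swap q).
- by apply/optionsP; rewrite -(swapK p); exact: rwythoff_move_swap.
- rewrite -{1}(swapK q); apply: IH.
  have := rwythoff_move_lt (rwythoff_move_swap hq); rewrite swapK => h.
  exact: leq_trans h hp.
- by apply/optionsP; exact: rwythoff_move_swap.
- by symmetry; apply: IH; apply: leq_trans (rwythoff_move_lt hq) hp.
Qed.

(* Main.v *)
Require Import Defs.
From mathcomp Require Import all_boot all_order all_algebra.
From mathcomp Require Import zify.

(** Write [v = G(a, b)] and suppose [v + 2a <= b].  A column [a + d] with
    [a <= a + d < b] cannot carry the value [v] in row [a], so either
    [G(a, a + d) < v], or [v] occurs on the diagonal below [(a, a + d)], that is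
    [v = G(r, r + d)] for some row [r < a].  A row does not repeat a value beyond
    its diagonal entry, so sending [d] to [G(a, a + d)] or to [v + r] is an
    injection of [b - a >= v + a] columns into [v + a] labels.  It misses a label,
    a contradiction: if [a < v] it misses the value [a = G(a, 0)]; if [0 < v < a]
    it misses the row [v], where [v = G(v, 0)] lies before the diagonal; if [v = 0]
    it misses the row [2], because [G(2, 1) = 0].  Finally [v = a] is impossible
    since [G(a, 0) = a]. *)

Lemma rwythoff_move_grundyR_neq (p q : position) :
  rwythoff_move p q -> grundyR q <> grundyR p.
Proof.
move=> /optionsP hq e; move: (grundyR_mex p); rewrite /mex.
case: ex_minnP => m hm _ hp; case/negP: hm.
by apply/mapP; exists q => //; rewrite -hp e.
Qed.

Lemma grundyR_lt_option (p : position) (w : nat) :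
  w < grundyR p -> exists2 q, rwythoff_move p q & grundyR q = w.
Proof.
rewrite grundyR_mex /mex; case: ex_minnP => m _ minm hw.
have /mapP[q /optionsP hq ->] : w \in [seq grundyR q | q <- options p].
  by apply: contraLR hw => /minm; rewrite -leqNgt.
by exists q.
Qed.

(** Since [r <= c], the right pile may be reduced to any [c' < c], even below [r]. *)
Lemma grundyR_row_neq (r c c' : nat) :
  r <= c -> c' < c -> grundyR (r, c') <> grundyR (r, c).
Proof.
move=> rc c'c; apply: rwythoff_move_grundyR_neq.
have -> : c' = c - (c - c') by lia.
by apply: MoveRight => //; lia.
Qed.

Lemma grundyR_row_inj (r c c' : nat) :
  r <= c -> r <= c' -> grundyR (r, c) = grundyR (r, c') -> c = c'.
Proof.
move=> rc rc' e; case: (ltngtP c c') => // h.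
  by case: (@grundyR_row_neq r c' c).
by case: (@grundyR_row_neq r c c').
Qed.

Lemma grundyR0n (n : nat) : grundyR (0, n) = n.
Proof.
elim/ltn_ind: n => n IH; case: (ltngtP (grundyR (0, n)) n) => // h.
  by case: (@grundyR_row_neq 0 n (grundyR (0, n))) => //; rewrite IH.
have [q hq] := @grundyR_lt_option _ _ h.
inversion hq as [x y k hk hxy|x y k hk hxy|x y k hk]; subst; try lia.
by rewrite IH; lia.
Qed.

Lemma grundyRn0 (n : nat) : grundyR (n, 0) = n.
Proof. exact: etrans (grundyR_swap (0, n)) (grundyR0n n). Qed.

(** The options [(1, 1)], [(0, 1)], [(1, 0)] all have nonzero value, the first because it moves to
    [(0, 0)]. *)
Lemma grundyR_2_1 : grundyR (2, 1) = 0.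
Proof.
case: (posnP (grundyR (2, 1))) => // /grundyR_lt_option[q /optionsP].
have h11 : grundyR (1, 1) <> 0.
  rewrite -[X in _ <> X](grundyR0n 0) => /esym.
  by apply: rwythoff_move_grundyR_neq; exact: (@MoveBoth 1 1 1).
by rewrite !inE => /or3P[] /eqP -> //; rewrite ?grundyR0n ?grundyRn0.
Qed.

Lemma grundyR_blocked (a b d : nat) :
  a + d < b -> grundyR (a, b) <= grundyR (a, a + d) ->
  exists2 r, r < a & grundyR (r, r + d) = grundyR (a, b).
Proof.
move=> adb; rewrite leq_eqVlt => /orP[/eqP/esym e|].
  by case: (@grundyR_row_neq a b (a + d)) => //; lia.
case/grundyR_lt_option => q hq.
inversion hq as [x y k hk hxy|x y k hk hxy|x y k hk]; subst=> e.
(* A left move forces [d = 0], so its target mirrors a position of row [a]. *)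
- case: (@grundyR_row_neq a b (a - k)); [lia|lia|].
  have -> : grundyR (a, a - k) = grundyR (a - k, a + d).
    have -> : a + d = a by lia.
    exact: (grundyR_swap (a - k, a)).
  exact: e.
- by case: (@grundyR_row_neq a b (a + d - k)); [lia|lia|].
- exists (a - k); first by lia.
  by rewrite -e; congr (grundyR (_, _)); lia.
Qed.

Lemma grundyR_lower_bound (a b : nat) :
  2 < a -> a <= b -> b < grundyR (a, b) + 2 * a.
Proof.
move=> a2 ab; set v := grundyR (a, b); rewrite ltnNge; apply/negP => hb.
(* The default of [find] here is [a], which [rowP] excludes where [row] matters. *)
pose row d := find (fun r => grundyR (r, r + d) == v) (iota 0 a).
(* Values stay below [v] and rows are shifted by [v], so the two kinds of label never collide. *)
pose f d := if grundyR (a, a + d) < v then grundyR (a, a + d) else v + row d.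
have rowP d : d < b - a -> v <= grundyR (a, a + d) ->
    row d < a /\ grundyR (row d, row d + d) = v.
  move=> hd hv; have [|r ra er] := @grundyR_blocked a b d _ hv; first by lia.
  have hh : has (fun r => grundyR (r, r + d) == v) (iota 0 a).
    by apply/hasP; exists r; rewrite ?mem_iota //; apply/eqP.
  have hr : row d < a by rewrite -[X in _ < X](size_iota 0) -has_find.
  by split=> //; have /eqP := nth_find 0 hh; rewrite nth_iota.
have f_inj : {in iota 0 (b - a) &, injective f}.
  move=> d d'; rewrite !mem_iota !add0n /f => hd hd'.
  case: ltnP => h; case: ltnP => h'.
  - by move/grundyR_row_inj => e; have := e (leq_addr _ _) (leq_addr _ _); lia.
  - by lia.
  - by lia.
  move/addnI => e; have [_ e1] := rowP _ hd h; have [_ e2] := rowP _ hd' h'.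
  move: e1; rewrite e -e2.
  by move/grundyR_row_inj => e3; have := e3 (leq_addr _ _) (leq_addr _ _); lia.
have [m hm fm] : exists2 m, m < v + a & forall d, d < b - a -> f d <> m.
  (* A [v] left of the diagonal in row [r] bars [v] from [(r, r + d)]. *)
  have miss r c : r < a -> c < r -> grundyR (r, c) = v ->
      forall d, d < b - a -> f d <> v + r.
    move=> ra cr e d hd; rewrite /f; case: ltnP => h; first by lia.
    move/addnI => er; have [_] := rowP _ hd h; rewrite er -e => /esym.
    by apply: grundyR_row_neq; lia.
  case: (posnP v) => v0.
    exists (v + 2); first by lia.
    by apply: (miss 2 1) => //; rewrite v0 grundyR_2_1.
  case: (ltngtP v a) => va.
  - exists (v + v); first by lia.
    by apply: (miss v 0) => //; rewrite grundyRn0.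
  - exists a; first by lia.
    move=> d hd.
    rewrite /f; case: ltnP => h; last by lia.
    rewrite -[X in _ <> X]grundyRn0 => /esym.
    by apply: grundyR_row_neq; lia.
  case: (@grundyR_row_neq a b 0) => //; first by lia.
  exact: etrans (grundyRn0 a) (esym va).
(* Pigeonhole: [m] and the [b - a] labels used are distinct numbers below [v + a]. *)
have us : uniq (m :: map f (iota 0 (b - a))).
  rewrite cons_uniq map_inj_in_uniq // iota_uniq andbT.
  apply/mapP => -[d]; rewrite mem_iota => hd /esym; exact: fm.
have := uniq_leq_size us (s2 := iota 0 (v + a)).
rewrite /= size_map !size_iota => hs.
suff : (b - a).+1 <= v + a by lia.
apply: hs => x; rewrite inE mem_iota add0n => /orP[/eqP -> //|].
case/mapP => d; rewrite mem_iota add0n => hd ->; rewrite /f.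
by case: ltnP => h; [lia | have [] := rowP _ hd h; lia].
Qed.

Local Open Scope ring_scope.

Theorem theorem2p13 (a b : nat) (ha : (4 <= a)%N) (hab : (a <= b)%N) :
  b%:Z - 2%:Z * a%:Z + 1 <= (grundyR (a, b))%:Z.
Proof.
have a2 : (2 < a)%N by exact: ltn_trans ha.
by have := @grundyR_lower_bound a b a2 hab; lia.
Qed.
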